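(* Let $(X_n)_{n\ge0}$ be the two-armed $\sigma$-over-penalized Narendra-Shapiro algorithm with success probabilities $(p_1,p_2)$, i.e. for all $n\ge0$ $$X_{n+1}=X_n+\gamma_{n+1}\left[\mathbf 1_{\{I_{n+1}=1\}}-X_n\right]A_{n+1}^{I_{n+1}}-\gamma_{n+1}\rho_{n+1}\left[X_n\mathbf 1_{\{I_{n+1}=1\}}-(1-X_n)\mathbf 1_{\{I_{n+1}=2\}}\right]\left(1-A_{n+1}^{I_{n+1}}B_{n+1}^\sigma\right),$$ with $\sigma\in[0,1)$, $\gamma_n=\gamma_1/\sqrt n$ and $\rho_n=\rho_1/\sqrt n$ for $n\ge1$, where $(\gamma_1,\rho_1)\in(0,1)^2$. Let $\bar R_n$ be its pseudo-regret. Then: (a) There exists a constant $C_\sigma(\gamma_1,\rho_1)$ such that $$\forall n\in\mathbb N,\qquad \sup_{(p_1,p_2)\in[0,1]^2,\ p_2<p_1}\bar R_n\le C_\sigma(\gamma_1,\rho_1)\sqrt n .$$ (b) Furthermore, the choice $\sigma=0$, $\gamma_n=2.63\,\rho_n=0.89/\sqrt n$ yields $$\forall n\in\mathbb N,\qquad \sup_{(p_1,p_2)\in[0,1]^2,\ p_2<p_1}\bar R_n\le 31.1\sqrt{2n}.$$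
   Context: There are two arms $1,2$ with success probabilities $p_1,p_2$. The rewards $(A_n^i)_{n\ge1}$, $i\in\{1,2\}$, are two independent sequences of i.i.d. Bernoulli random variables, $A_n^i\sim\mathcal B(p_i)$. $(B_n^\sigma)_{n\ge1}$ is a sequence of i.i.d. Bernoulli variables with $\mathbb P(B_n^\sigma=1)=\sigma$, $\mathbb P(B_n^\sigma=0)=1-\sigma$, independent of the rewards. $I_n\in\{1,2\}$ is the arm played at time $n\ge1$. $X_n\in[0,1]$ is the probability of playing arm $1$ at time $n+1$: the process starts from a fixed deterministic $X_0\in(0,1)$ and, conditionally on the history $\mathcal F_n=\sigma((I_k,A_k^{I_k},B_k^\sigma),1\le k\le n)$, $\mathbb P(I_{n+1}=1\mid\mathcal F_n)=X_n$, $\mathbb P(I_{n+1}=2\mid\mathcal F_n)=1-X_n$, while $(A_{n+1}^1,A_{n+1}^2,B_{n+1}^\sigma)$ is independent of $\mathcal F_n$ and $I_{n+1}$. The pseudo-regret is $$\bar R_n=\max_{j\in\{1,2\}}\mathbb E\sum_{k=1}^n\left[A_k^j-A_k^{I_k}\right].$$ The constant in (a) does not depend on $n,p_1,p_2$. *)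

(* Defs.v *)
From HB Require Import structures.
From mathcomp Require Import all_boot all_order all_algebra.
From mathcomp Require Import all_classical all_reals all_analysis.

Set Implicit Arguments.
Unset Strict Implicit.
Unset Printing Implicit Defensive.

Import Order.TTheory GRing.Theory Num.Theory.
Import numFieldNormedType.Exports.

Local Open Scope classical_set_scope.
Local Open Scope ring_scope.

(* The two arms are the booleans, and so are the values of a Bernoulli variable,
   [true] standing for 1. *)
Notation arm1 := true (only parsing).
Notation arm2 := false (only parsing).

Section independence.
Context d (T : measurableType d) (R : realType) (P : probability T R).

Definition independent_set_systems (F G : set (set T)) : Prop :=
  forall E E', F E -> G E' -> P (E `&` E') = (P E * P E')%E.

Definition independent_RVs d' (S : measurableType d') (K : eqType)
    (Y : K -> T -> S) : Prop :=
  forall (s : seq K) (D : K -> set S), uniq s ->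
    (forall k, k \in s -> measurable (D k)) ->
    P (\bigcap_(k in [set` s]) (Y k @^-1` D k)) =
      (\prod_(k <- s) P (Y k @^-1` D k))%E.

(* [f] is a version of the conditional probability of [E] given the
   sigma-algebra [G]. *)
Definition is_cond_prob (G : set (set T)) (E : set T) (f : T -> R) : Prop :=
  (forall D : set R, measurable D -> G (f @^-1` D)) /\
  (forall H, G H -> P (H `&` E) = (\int[P]_(w in H) (f w)%:E)%E).

End independence.

(* In all that follows the time indices of [A], [B] and [I] start at 1; the
   variables of index 0 are unused. *)

Section narendra_shapiro.
Context (T : Type) (R : realType).
Variables (gamma rho : R^nat) (x0 : R).
Variables (A : bool -> nat -> T -> bool) (B I : nat -> T -> bool).

Definition obtained_reward (n : nat) (w : T) : bool := A (I n w) n w.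

Fixpoint ns_prob (n : nat) (w : T) : R :=
  if n is m.+1 then
    let x := ns_prob m w in
    x + gamma n * ((I n w == arm1)%:R - x) * (obtained_reward n w)%:R
      - gamma n * rho n
        * (x * (I n w == arm1)%:R - (1 - x) * (I n w == arm2)%:R)
        * (1 - (obtained_reward n w)%:R * (B n w)%:R)
  else x0.

Definition observation (n : nat) (w : T) : bool * bool * bool :=
  (I n w, obtained_reward n w, B n w).

Definition history_generator (n : nat) : set (set T) :=
  \bigcup_(k in [set k | 1 <= k <= n]%N)
    preimage_set_system setT (observation k) measurable.

Definition history (n : nat) : set (set T) := <<s history_generator n >>.

Definition history_and_choice (n : nat) : set (set T) :=
  <<s history_generator n `|`
      preimage_set_system setT (I n.+1) measurable >>.

Definition fresh_noise (n : nat) (w : T) : bool * bool * bool :=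
  (A arm1 n w, A arm2 n w, B n w).

(* [inl (i, n)] indexes the reward A_(n+1) of arm i, [inr n] indexes B_(n+1). *)
Definition noise_family (k : (bool * nat) + nat) : T -> bool :=
  match k with
  | inl (i, n) => A i n.+1
  | inr n => B n.+1
  end.

End narendra_shapiro.

Section bandit.
Context d (T : measurableType d) (R : realType) (P : probability T R).

Record over_penalized_bandit (sigma : R) (gamma rho : R^nat) (x0 : R)
    (p : bool -> R) (A : bool -> nat -> {RV P >-> bool})
    (B I : nat -> {RV P >-> bool}) : Prop := {
  reward_law : forall i n, distribution P (A i n.+1) =1 bernoulli_prob (p i) ;
  penalty_law : forall n, distribution P (B n.+1) =1 bernoulli_prob sigma ;
  noise_independent : independent_RVs P (noise_family A B) ;
  arm1_cond_prob : forall n,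
    is_cond_prob P (history A B I n) (I n.+1 @^-1` [set arm1])
      (ns_prob gamma rho x0 A B I n) ;
  arm2_cond_prob : forall n,
    is_cond_prob P (history A B I n) (I n.+1 @^-1` [set arm2])
      (fun w => 1 - ns_prob gamma rho x0 A B I n w) ;
  noise_fresh : forall n,
    independent_set_systems P
      (preimage_set_system setT (fresh_noise A B n.+1) measurable)
      (history_and_choice A B I n)
}.

Definition pseudo_regret (A : bool -> nat -> {RV P >-> bool})
    (I : nat -> {RV P >-> bool}) (n : nat) : \bar R :=
  let gap (j : bool) (w : T) : R :=
    \sum_(1 <= k < n.+1) ((A j k w)%:R - (obtained_reward A I k w)%:R) in
  maxe 'E_P[gap arm1]%E 'E_P[gap arm2]%E.

End bandit.

(* Supremum of the pseudo-regret at time [n] over all 0 <= p2 < p1 <= 1. The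
   pseudo-regret only depends on the law of the process, so letting the
   realization range over all probability spaces does not enlarge the set. *)
Definition worst_pseudo_regret (R : realType) (sigma : R) (gamma rho : R^nat)
    (x0 : R) (n : nat) : \bar R :=
  ereal_sup [set r : \bar R |
    exists (p : bool -> R) (d : measure_display) (T : measurableType d)
           (P : probability T R) (A : bool -> nat -> {RV P >-> bool})
           (B I : nat -> {RV P >-> bool}),
      [/\ 0 <= p arm2, p arm2 < p arm1, p arm1 <= 1,
          over_penalized_bandit sigma gamma rho x0 p A B I &
          r = pseudo_regret A I n]].

(* Main.v *)
Require Import Defs.
From HB Require Import structures.
From mathcomp Require Import all_boot all_order all_algebra.
From mathcomp Require Import all_classical all_reals all_analysis.
From mathcomp Require Import ring lra.

Set Implicit Arguments.
Unset Strict Implicit.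
Unset Printing Implicit Defensive.

Import Order.TTheory GRing.Theory Num.Theory.
Import numFieldNormedType.Exports.

Local Open Scope classical_set_scope.
Local Open Scope ring_scope.

(* Write pi = p1 - p2 and x = X_k, so that the regret is the sum of the
   pi * E[1 - X_k].  The logarithm of the odds x / (1 - x) has drift
   gamma * pi, but the jumps of size gamma defeat any potential that is singular
   at x = 0.  The regularized odds
     Q_k(x) = (1 - x) / (x + d / (pi sqrt (k + 1)))
   still contract at relative rate c gamma1 pi / sqrt (k + 1): away from 0 the
   regularization makes the second-order term gamma^2 x / (x + delta) smaller
   than the drift pi x, and near 0 the penalty rho pushes x upwards.
   Hence sqrt (k + 1) * E[Q_k] decreases by a multiple of pi * E[Q_k], up to a
   source O(1 / sqrt k) due to the penalty near x = 1, as soon as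
   pi sqrt (k + 1) >= s0.  Summing from the first such k, where the potential is
   O(1 / pi), bounds the regret by M1 / pi + M2 sqrt n; together with the trivial
   bound pi * n this is O(sqrt n) uniformly in pi. *)

(** * One transition of the chain *)

Section transition.
Variable R : realType.
Implicit Types (g r x sigma q : R) (p : bool -> R) (z : bool * bool * bool).

(* An outcome [(i, a, b)] lists the arm played, the reward obtained and the
   value of the penalty variable. *)
Definition ns_step g r x z : R :=
  x + g * ((z.1.1 == arm1)%:R - x) * z.1.2%:R
    - g * r * (x * (z.1.1 == arm1)%:R - (1 - x) * (z.1.1 == arm2)%:R)
      * (1 - z.1.2%:R * z.2%:R).

Definition bern q (b : bool) : R := if b then q else 1 - q.

Definition outcome_prob p sigma x z : R :=
  bern x z.1.1 * bern (p z.1.1) z.1.2 * bern sigma z.2.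

Definition outcome_mean p sigma x (h : bool * bool * bool -> R) : R :=
  \sum_z outcome_prob p sigma x z * h z.

Lemma outcome_meanE p sigma x h : outcome_mean p sigma x h =
  x * (p true * (sigma * h (true, true, true)
                 + (1 - sigma) * h (true, true, false))
       + (1 - p true) * (sigma * h (true, false, true)
                         + (1 - sigma) * h (true, false, false)))
  + (1 - x) * (p false * (sigma * h (false, true, true)
                          + (1 - sigma) * h (false, true, false))
       + (1 - p false) * (sigma * h (false, false, true)
                          + (1 - sigma) * h (false, false, false))).
Proof.
rewrite /outcome_mean; transitivity (\sum_i \sum_a \sum_b
    outcome_prob p sigma x (i, a, b) * h (i, a, b)).
  rewrite pair_bigA (pair_bigA _ (fun u b => outcome_prob p sigma x (u.1, u.2, b)
    * h (u.1, u.2, b))) /=.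
  by apply: eq_bigr => -[[]].
rewrite !big_bool /outcome_prob /bern /=; ring.
Qed.

Lemma outcome_mean_lin p sigma x c h1 h2 :
  outcome_mean p sigma x (fun z => c * h1 z + h2 z) =
  c * outcome_mean p sigma x h1 + outcome_mean p sigma x h2.
Proof. by rewrite !outcome_meanE; ring. Qed.

Lemma outcome_mean_cst p sigma x c : outcome_mean p sigma x (fun=> c) = c.
Proof. by rewrite outcome_meanE; ring. Qed.

Lemma bern_ge0 q b : 0 <= q <= 1 -> 0 <= bern q b.
Proof. by move=> /andP[q0 q1]; case: b => //=; rewrite subr_ge0. Qed.

Lemma outcome_mean_le p sigma x h1 h2 : (forall i, 0 <= p i <= 1) ->
  0 <= sigma <= 1 -> 0 <= x <= 1 -> (forall z, h1 z <= h2 z) ->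
  outcome_mean p sigma x h1 <= outcome_mean p sigma x h2.
Proof.
move=> p01 s01 x01 h12; apply: ler_sum => z _; apply: ler_wpM2l => //.
by rewrite /outcome_prob !mulr_ge0 ?bern_ge0.
Qed.

Lemma ns_step_itv g r x z : 0 <= g <= 1 -> 0 <= r <= 1 -> 0 <= x <= 1 ->
  0 <= ns_step g r x z <= 1.
Proof.
move=> /andP[g0 g1] /andP[r0 r1] /andP[x0 x1].
have gr0 : 0 <= g * r by exact: mulr_ge0.
have gr1 : g * r <= 1 by rewrite mulr_ile1.
have grg : g * r <= g by rewrite ler_piMr.
by move: z => [[[] []] []]; rewrite /ns_step /=; apply/andP; split; nra.
Qed.

End transition.

(** * Expectations along the chain *)

Section expectation.
Variables (R : realType) (gamma rho : R^nat) (p : bool -> R) (sigma x0 : R).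

(** The expectation of [f (X_n)] for the chain started at [x0], by the backward recursion: the last
    transition is integrated into [f] first. [state_expectation] relates it to the probability
    space. *)
Fixpoint ns_expect (n : nat) (f : R -> R) : R :=
  if n is m.+1 then
    ns_expect m (fun x => outcome_mean p sigma x
                            (fun z => f (ns_step (gamma n) (rho n) x z)))
  else f x0.

Lemma ns_expect_lin n c f g :
  ns_expect n (fun x => c * f x + g x) = c * ns_expect n f + ns_expect n g.
Proof.
elim: n f g => //= n IH f g; rewrite -IH; congr ns_expect.
by apply/funext => x; exact: outcome_mean_lin.
Qed.

Lemma ns_expect_cst n c : ns_expect n (fun=> c) = c.
Proof.
elim: n => //= n IH; rewrite -[RHS]IH; congr ns_expect.
by apply/funext => x; exact: outcome_mean_cst.
Qed.

Lemma ns_expectZ n c f : ns_expect n (fun x => c * f x) = c * ns_expect n f.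
Proof.
have := ns_expect_lin n c f (fun=> 0); rewrite ns_expect_cst addr0 => <-.
by congr ns_expect; apply/funext => x; rewrite addr0.
Qed.

Hypotheses (gamma01 : forall n, 0 <= gamma n.+1 <= 1)
  (rho01 : forall n, 0 <= rho n.+1 <= 1) (p01 : forall i, 0 <= p i <= 1)
  (sigma01 : 0 <= sigma <= 1) (x001 : 0 <= x0 <= 1).

(** A comparison on [[0, 1]] suffices because [ns_step_itv] keeps the chain there. *)
Lemma ns_expect_le n f g : (forall x, 0 <= x <= 1 -> f x <= g x) ->
  ns_expect n f <= ns_expect n g.
Proof.
elim: n f g => [|n IH] f g fg /=; first exact: fg.
apply: IH => x x01; apply: outcome_mean_le => // z.
by apply: fg; exact: ns_step_itv.
Qed.

End expectation.

(** * Second-order drift of the regularized odds *)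

Section drift.
Variable R : realType.
Implicit Types (a t D x delta g r : R).

(** The expansion is exact with remainder [D ^+ 2 / (a ^+ 2 * (a + D))], and [a + D] is at least
    [a * (1 - t)]. *)
Lemma inv_second_order_le a t D : 0 < a -> 0 <= t < 1 -> - (t * a) <= D ->
  (a + D)^-1 <= a^-1 - D / a ^+ 2 + D ^+ 2 / (a ^+ 3 * (1 - t)).
Proof.
move=> a0 /andP[t0 t1] tD.
have at0 : 0 < a * (1 - t) by rewrite mulr_gt0 ?subr_gt0.
have atD : a * (1 - t) <= a + D by nra.
have aD0 : 0 < a + D by exact: lt_le_trans atD.
have t10 : 0 < 1 - t by rewrite subr_gt0.
have -> : (a + D)^-1 = a^-1 - D / a ^+ 2 + D ^+ 2 / a ^+ 2 / (a + D).
  by field; rewrite !gt_eqF.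
rewrite lerD2l; have -> : D ^+ 2 / (a ^+ 3 * (1 - t)) =
    D ^+ 2 / a ^+ 2 / (a * (1 - t)) by field; rewrite !gt_eqF.
apply: ler_wpM2l; first by rewrite mulr_ge0 ?sqr_ge0 ?invr_ge0 ?exprn_ge0 ?ltW.
by rewrite lef_pV2 ?posrE.
Qed.

Definition odds delta x : R := (1 - x) / (x + delta).

Lemma oddsE delta x : 0 < x + delta ->
  odds delta x = (1 + delta) * (x + delta)^-1 - 1.
Proof. by move=> a0; rewrite /odds; field; rewrite gt_eqF. Qed.

Variables (p : bool -> R) (sigma : R).
Hypotheses (p01 : forall i, 0 <= p i <= 1) (sigma01 : 0 <= sigma <= 1).

(** The exact mean of the increment [ns_step g r x z - x]. *)
Definition step_drift g r x : R :=
  g * (p true - p false) * x * (1 - x)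
  - g * r * (x ^+ 2 * (1 - sigma * p true)
             - (1 - x) ^+ 2 * (1 - sigma * p false)).

(** Dominates the second moment of the increment: reward and penalty push in opposite directions, so
    their cross terms are nonpositive and are dropped. *)
Definition step_variance_bound g r x : R :=
  g ^+ 2 * (p true * x * (1 - x) ^+ 2 + p false * (1 - x) * x ^+ 2
            + r ^+ 2 * (x ^+ 3 + (1 - x) ^+ 3)).

Lemma odds_step_le g r delta x : 0 <= g < 1 -> 0 <= r <= 1 -> 0 <= x <= 1 ->
  0 < delta ->
  outcome_mean p sigma x (fun z => odds delta (ns_step g r x z)) <=
  odds delta x - (1 + delta) / (x + delta) ^+ 2 *
    (step_drift g r x - step_variance_bound g r x / ((1 - g) * (x + delta))).
Proof.
move=> /andP[g0 g1] /andP[r0 r1] /andP[x0 x1] d0.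
have a0 : 0 < x + delta by lra.
have g10 : 0 < 1 - g by lra.
(* [g ^+ 2 * s z] bounds the squared increment for the outcome [z], and its mean is
   [step_variance_bound]. *)
pose s (z : bool * bool * bool) : R := if z.1.1 then z.1.2%:R * (1 - x) ^+ 2 + r ^+ 2 * x ^+ 2
                else z.1.2%:R * x ^+ 2 + r ^+ 2 * (1 - x) ^+ 2.
set a := x + delta in a0 *.
pose Q z : R := (1 + delta) * (a^-1 - (ns_step g r x z - x) / a ^+ 2
   + g ^+ 2 * s z / (a ^+ 3 * (1 - g))) - 1.
apply: (@le_trans _ _ (outcome_mean p sigma x Q)).
  apply: outcome_mean_le => //; first by rewrite x0.
  move=> z; have /andP[z0 z1] : 0 <= ns_step g r x z <= 1.
    by apply: ns_step_itv; rewrite ?x0 ?g0 ?r0 // ltW.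
  rewrite oddsE ?ltr_wpDl // lerD2r ler_pM2l ?addr_gt0 //.
  have -> : ns_step g r x z + delta = a + (ns_step g r x z - x).
    by rewrite /a; ring.
  have gr0 : 0 <= g * r by exact: mulr_ge0.
  have grg : g * r <= g by rewrite ler_piMr.
  have gd0 : 0 <= g * delta by rewrite mulr_ge0 // ltW.
  (* Take [t = g]: a step never lowers the state by more than [g * x], hence by no more than
     [g * a]. *)
  apply: (le_trans (@inv_second_order_le a g _ a0 _ _)).
  - by rewrite g0.
  - by move: z {z0 z1} => [[[] []] []]; rewrite /ns_step /a /=; nra.
  rewrite lerD2l ler_pM2r ?invr_gt0 ?mulr_gt0 ?exprn_gt0 //.
  have -> : ns_step g r x z - x = g * ((ns_step 1 r x z) - x).
    by rewrite /ns_step; ring.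
  rewrite exprMn; apply: ler_wpM2l; first exact: sqr_ge0.
  have rxy : 0 <= r * (x * (1 - x)) by rewrite !mulr_ge0 //; lra.
  have rx := sqr_ge0 (r * x); have ry := sqr_ge0 (r * (1 - x)).
  by move: z {z0 z1} => [[[] []] []]; rewrite /ns_step /s /=; nra.
rewrite le_eqVlt; apply/orP; left; apply/eqP.
rewrite outcome_meanE /Q /s /ns_step /step_drift /step_variance_bound oddsE -/a //=.
by field; rewrite !gt_eqF.
Qed.

End drift.

(** * Potential and regret of the Markov chain *)

Section lyapunov.
(* The potential estimates hold once [gap * sqrt (k + 1) >= s0]; [d] is the
   regularization of the odds, [c] their relative decay rate, [K] bounds the
   effect of the penalty near [x = 1], and [G] bounds
   [gamma1 / (1 - gamma_(k+1))].  In [drift_ge], [u] stands for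
   [gap * sqrt (k + 1) * x]. *)
Variables (R : realType) (gamma1 rho1 sigma s0 d c G K : R).
Hypotheses (gamma1_itv : 0 < gamma1 < 1) (rho1_itv : 0 < rho1 < 1)
  (sigma_itv : 0 <= sigma < 1) (s0_gt1 : 1 < s0) (d_gt0 : 0 < d) (c_gt0 : 0 < c)
  (G_ge : gamma1 <= G * (1 - gamma1 / s0))
  (K_ge : gamma1 * rho1 * (1 + d / s0) * (1 + G * rho1 / s0 ^+ 2) <= K)
  (drift_ge : forall u : R, 0 <= u ->
     c * (u + d) <= u * (1 - rho1 / s0) + rho1 * (1 - sigma)
                    - G * (u / (u + d)) - G * rho1 ^+ 2 / (s0 * d)).
Variable p : bool -> R.
Hypotheses (p2_ge0 : 0 <= p false) (p2_lt_p1 : p false < p true)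
  (p1_le1 : p true <= 1).

Variable gap : R.
Hypothesis gapE : gap = p true - p false.

Let p01 i : 0 <= p i <= 1.
Proof. by move: p2_ge0 p2_lt_p1 p1_le1 => *; case: i; apply/andP; split; lra. Qed.

Let gap_gt0 : 0 < gap. Proof. by rewrite gapE subr_gt0. Qed.
Let gap_le1 : gap <= 1. Proof. by rewrite gapE; move: p2_ge0 p1_le1; lra. Qed.

Let s0_gt0 : 0 < s0. Proof. exact: lt_trans s0_gt1. Qed.
Let gamma1_lts0 : gamma1 / s0 < 1.
Proof. by rewrite ltr_pdivrMr //; case/andP: gamma1_itv; move: s0_gt1; lra. Qed.
Let G_gt0 : 0 < G.
Proof.
case/andP: gamma1_itv => g0 _; rewrite -(@pmulr_lgt0 _ (1 - gamma1 / s0)).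
  exact: lt_le_trans G_ge.
by rewrite subr_gt0.
Qed.

(** * Contraction at one time, [r] standing for sqrt (k + 1) *)

Section one_step.
Variables (r x : R).
Hypotheses (r_ge : s0 <= gap * r) (x01 : 0 <= x <= 1).

Let delta := d / (gap * r).
Let a := x + delta.
Let r_ges0 : s0 <= r.
Proof.
have r0 : 0 <= r by rewrite -(pmulr_rge0 _ gap_gt0) (le_trans _ r_ge) // ltW.
by apply: le_trans r_ge _; exact: ler_piMl.
Qed.
Let r_gt0 : 0 < r. Proof. exact: lt_le_trans r_ges0. Qed.
Let delta_gt0 : 0 < delta. Proof. by rewrite divr_gt0 ?mulr_gt0. Qed.
Let a_gt0 : 0 < a. Proof. by rewrite ltr_wpDl //; case/andP: x01. Qed.

Let gammar_itv : 0 < gamma1 / r < 1.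
Proof.
by rewrite divr_gt0 ?ltr_pdivrMr //; case/andP: gamma1_itv => //; move: s0_gt1 r_ges0; lra.
Qed.

(** The left side decreases in [r], and [G_ge] is the bound at [r = s0]. *)
Lemma step_G_ge : gamma1 / (1 - gamma1 / r) <= G.
Proof.
case/andP: gammar_itv => _ g1; rewrite ler_pdivrMr ?subr_gt0 //.
apply: (le_trans G_ge); rewrite ler_pM2l // lerD2l lerN2.
by rewrite ler_pM2l ?lef_pV2 ?posrE //; case/andP: gamma1_itv.
Qed.

(** Multiplied by [r], this follows from [drift_ge] at [u = gap * r * x], where
    [u + d = gap * r * a]. The error terms are first replaced by bounds in which [gap] and [r] enter
    only through [u], using [s0 <= gap * r]. *)
Lemma pointwise_drift_ge :
  c * gap * a <= gap * x + rho1 / r * (1 - sigma) * (1 - x)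
    - gamma1 / r * x / ((1 - gamma1 / r) * a)
    - gamma1 / r * (rho1 / r) ^+ 2 / ((1 - gamma1 / r) * a).
Proof.
case/andP: gammar_itv => _ g1; have g10 : 0 < 1 - gamma1 / r by lra.
case/andP: x01 => x0 x1; case/andP: rho1_itv => rho0 _.
case/andP: sigma_itv => sg0 sg1; case/andP: gamma1_itv => gm0 _.
have gr0 : 0 < gap * r by exact: mulr_gt0.
pose u := gap * r * x.
have u0 : 0 <= u by rewrite mulr_ge0 // ltW.
have ud : u + d = gap * r * a.
  by rewrite /u /a /delta; field; rewrite !gt_eqF.
have /(le_trans _) := drift_ge u0 => H.
rewrite -(ler_pM2l r_gt0); apply: le_trans (H _ _) _; clear H.
  by rewrite ud le_eqVlt; apply/orP; left; apply/eqP; ring.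
have -> : u / (u + d) = x / a.
  by rewrite ud /u; field; rewrite !gt_eqF.
have e1 : gamma1 / (1 - gamma1 / r) * (x / a) <= G * (x / a).
  by apply: ler_wpM2r; [rewrite divr_ge0 // ltW | exact: step_G_ge].
have e2 : gamma1 / (1 - gamma1 / r) * (rho1 ^+ 2 / (r ^+ 2 * a)) <=
          G * (rho1 ^+ 2 / (s0 * d)).
  apply: ler_pM; last 2 first.
  - exact: step_G_ge.
  - rewrite ler_pM2l ?exprn_gt0 // lef_pV2 ?posrE ?mulr_gt0 ?exprn_gt0 //.
    have h1 : d <= gap * r * a by rewrite -ud lerDr.
    have h2 : gap * r * a <= r * a by rewrite ler_pM2r // ger_pMl.
    rewrite expr2 -mulrA; apply: ler_pM (r_ges0) (le_trans h1 h2); exact: ltW.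
  - by rewrite divr_ge0 // ltW.
  - by rewrite divr_ge0 ?mulr_ge0 ?sqr_ge0 // ltW.
have e3 : rho1 * x <= u * (rho1 / s0).
  have h : s0 * (rho1 * x) <= u * rho1.
    rewrite /u -mulrA [x * rho1]mulrC; apply: ler_wpM2r => //.
    by rewrite mulr_ge0 // ltW.
  by rewrite mulrA ler_pdivlMr // mulrC.
have e4 : 0 <= rho1 * x * sigma by rewrite !mulr_ge0 // ltW.
have -> : r * (gap * x + rho1 / r * (1 - sigma) * (1 - x)
    - gamma1 / r * x / ((1 - gamma1 / r) * a)
    - gamma1 / r * (rho1 / r) ^+ 2 / ((1 - gamma1 / r) * a)) =
   u + rho1 * (1 - sigma) * (1 - x)
   - gamma1 / (1 - gamma1 / r) * (x / a)
   - gamma1 / (1 - gamma1 / r) * (rho1 ^+ 2 / (r ^+ 2 * a)).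
  rewrite /u; set g := 1 - _ in g10 *; field; rewrite !gt_eqF //.
rewrite -[G * _ / _]mulrA.
move: e1 e2; move: (_ * (x / a)) (G * (x / a)) => A1 A2.
move: (_ * (_ / (r ^+ 2 * a))) (G * (_ / _)) => A3 A4; move: e3.
by move: (rho1 / s0) => A5; lra.
Qed.

(** The part of drift minus variance that carries a factor [1 - x] is controlled by
    [pointwise_drift_ge] and gives the contraction. The penalty does not vanish at [x = 1]; what it
    leaves there is the source [K / r ^+ 2]. *)
Lemma odds_drift_le :
  outcome_mean p sigma x
    (fun z => odds delta (ns_step (gamma1 / r) (rho1 / r) x z)) <=
  odds delta x * (1 - gamma1 * c * gap / r) + K / r ^+ 2.
Proof.
case/andP: gammar_itv => g0 g1; have g10 : 0 < 1 - gamma1 / r by lra.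
case/andP: x01 => x0 x1; case/andP: (rho1_itv) => rho0 rho1'.
case/andP: (sigma_itv) => sg0 sg1; case/andP: (gamma1_itv) => gm0 gm1.
have rr0 : 0 < rho1 / r by rewrite divr_gt0.
case/andP: (p01 true) => pt0 pt1; case/andP: (p01 false) => pf0 pf1.
have rr1 : rho1 / r <= 1 by rewrite ler_pdivrMr //; move: s0_gt1 r_ges0; lra.
apply: le_trans (odds_step_le p01 _ _ _ _ _) _ => //.
- by rewrite sg0 ltW.
- by rewrite ltW.
- by rewrite ltW.
have H := pointwise_drift_ge.
have G' := step_G_ge.
rewrite -/a in H *.
set g := gamma1 / r in g0 g1 g10 H G' *; set q := rho1 / r in rr0 rr1 H *.
set w := ((1 - g) * a)^-1 in H *.
have w0 : 0 < w by rewrite invr_gt0 mulr_gt0.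
have wx : x * w <= (1 - g)^-1.
  rewrite /w invfM mulrCA ger_pMr ?invr_gt0 // ler_pdivrMr // mul1r.
  by rewrite lerDl ltW.
have y0 : 0 <= 1 - x by lra.
(* Coefficient of the [x ^+ 2] terms without factor [1 - x]: the penalty drift, plus its share of
   the variance after one [x] is absorbed by [w]. *)
pose S := g * q * (1 + q * g / (1 - g)).
have var_le : step_variance_bound p g q x * w <=
    g * (1 - x) * (g * x * w + g * q ^+ 2 * w)
    + g * q * (q * g / (1 - g)) * x ^+ 2.
  have -> : g * (1 - x) * (g * x * w + g * q ^+ 2 * w)
    + g * q * (q * g / (1 - g)) * x ^+ 2 =
    g ^+ 2 * ((x * (1 - x) + q ^+ 2 * (1 - x)) * w + q ^+ 2 * x ^+ 2 / (1 - g)).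
    by ring.
  rewrite /step_variance_bound -mulrA; apply: ler_wpM2l; first exact: sqr_ge0.
  have q20 : 0 <= q ^+ 2 by exact: sqr_ge0.
  have h1 : p true * x * (1 - x) ^+ 2 + p false * (1 - x) * x ^+ 2
      <= x * (1 - x).
    have xy0 : 0 <= x * (1 - x) by exact: mulr_ge0.
    have -> : p true * x * (1 - x) ^+ 2 + p false * (1 - x) * x ^+ 2 =
      x * (1 - x) * (p true * (1 - x) + p false * x) by ring.
    by apply: ler_piMr => //; nra.
  have h2 : (1 - x) ^+ 3 <= 1 - x by rewrite ler_iXnr //; lra.
  have h3 : q ^+ 2 * x ^+ 3 * w <= q ^+ 2 * x ^+ 2 / (1 - g).
    have -> : q ^+ 2 * x ^+ 3 * w = q ^+ 2 * x ^+ 2 * (x * w) by ring.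
    by apply: ler_wpM2l => //; rewrite mulr_ge0 ?sqr_ge0.
  have h4 : q ^+ 2 * (1 - x) ^+ 3 * w <= q ^+ 2 * (1 - x) * w.
    by apply: ler_wpM2r; [exact: ltW | exact: ler_wpM2l].
  have := ler_wpM2r (ltW w0) h1; lra.
have drift : g * (1 - x) * (c * gap * a) - S * x ^+ 2 <=
    step_drift p sigma g q x - step_variance_bound p g q x * w.
  have gy0 : 0 <= g * (1 - x) by rewrite mulr_ge0 // ltW.
  have := ler_wpM2l gy0 H.
  have gq0 : 0 <= g * q by rewrite mulr_ge0 // ltW.
  have k1 : 0 <= g * q * x ^+ 2 * (sigma * p true).
    exact: mulr_ge0 (mulr_ge0 gq0 (sqr_ge0 _)) (mulr_ge0 sg0 pt0).
  have k2 : 0 <= g * q * (1 - x) ^+ 2 * (sigma * (1 - p false)).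
    apply: mulr_ge0 (mulr_ge0 gq0 (sqr_ge0 _)) (mulr_ge0 sg0 _); lra.
  by rewrite /step_drift /S -gapE; lra.
have D1 : 1 <= 1 + delta by rewrite lerDl ltW.
have ds0 : delta <= d / s0.
  by rewrite /delta ler_pM2l // lef_pV2 ?posrE ?mulr_gt0.
have S0 : 0 <= S.
  have g0' := ltW g0; have q0' := ltW rr0.
  apply: mulr_ge0; first exact: mulr_ge0.
  exact: addr_ge0 ler01 (divr_ge0 (mulr_ge0 q0' g0') (ltW g10)).
have SK : (1 + delta) * S <= K / r ^+ 2.
  have -> : S = gamma1 * rho1 / r ^+ 2 *
      (1 + gamma1 / (1 - g) * rho1 / r ^+ 2).
    rewrite /S; move: (1 - g) (g10) => h h0; rewrite /q /g.
    by field; rewrite !gt_eqF.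
  rewrite [leLHS](_ : _ = (gamma1 * rho1 * (1 + delta)
    * (1 + gamma1 / (1 - g) * rho1 / r ^+ 2)) / r ^+ 2); last by ring.
  rewrite ler_pM2r ?invr_gt0 ?exprn_gt0 //; apply: le_trans K_ge.
  have gr10 : 0 < gamma1 * rho1 by exact: mulr_gt0.
  apply: ler_pM.
  - by rewrite mulr_ge0 ?ltW // (lt_le_trans _ D1).
  - by rewrite addr_ge0 // !mulr_ge0 ?invr_ge0 ?sqr_ge0 ?ltW.
  - by rewrite ler_pM2l // lerD2l.
  - rewrite lerD2l; apply: ler_pM.
    + by rewrite !mulr_ge0 ?invr_ge0 ?ltW.
    + by rewrite invr_ge0 sqr_ge0.
    + by rewrite ler_pM2r.
    + by rewrite lef_pV2 ?posrE ?exprn_gt0 // ler_sqr // nnegrE ltW.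
(* Since [x <= a], the source stays bounded however small the regularization is. *)
have xa : (1 + delta) * (S * x ^+ 2) / a ^+ 2 <= (1 + delta) * S.
  rewrite ler_pdivrMr ?exprn_gt0 // -[leRHS]mulrA.
  apply: ler_wpM2l; first exact: le_trans D1.
  apply: ler_wpM2l => //.
  have xa : x <= a by rewrite /a lerDl ltW.
  by rewrite ler_sqr // nnegrE ltW.
(* One factor [a] cancels, which leaves the odds [(1 - x) / a]; the factor [1 + delta] is at least
   1. *)
have main : gamma1 * c * gap / r * odds delta x <=
    (1 + delta) * (g * (1 - x) * (c * gap * a)) / a ^+ 2.
  have -> : (1 + delta) * (g * (1 - x) * (c * gap * a)) / a ^+ 2 =
     (1 + delta) * (gamma1 * c * gap / r * odds delta x).
    by rewrite /odds /g -/a; field; rewrite !gt_eqF.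
  apply: ler_peMl => //; rewrite /odds -/a !mulr_ge0 ?invr_ge0 //; exact: ltW.
have f0 : 0 < (1 + delta) / a ^+ 2.
  by rewrite divr_gt0 ?exprn_gt0 // (lt_le_trans _ D1).
have := ler_wpM2l (ltW f0) drift.
rewrite [X in X <= _ -> _](_ : _ =
  (1 + delta) * (g * (1 - x) * (c * gap * a)) / a ^+ 2
  - (1 + delta) * (S * x ^+ 2) / a ^+ 2); last by ring.
move: main xa SK; rewrite [odds delta x * _]mulrBr mulr1 [odds delta x * _]mulrC.
move: (_ / a ^+ 2 * (_ - _)) ((1 + delta) * S) (_ / r * _) (K / r ^+ 2).
move: (odds delta x) (_ / a ^+ 2) (_ * (S * _) / a ^+ 2) => o m1 m2 m3 m4 m5 m6.
by lra.
Qed.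

End one_step.

(** * Summation over time *)

Section cumulated.
Variables (gamma rho : R^nat) (x0 : R).
Hypotheses (gammaE : forall k, gamma k.+1 = gamma1 / Num.sqrt k.+1%:R)
  (rhoE : forall k, rho k.+1 = rho1 / Num.sqrt k.+1%:R) (x0_itv : 0 < x0 < 1)
  (kappa_gt0 : 0 < gamma1 * c - s0^-1).

Let root k : R := Num.sqrt k.+1%:R.
(** Decay rate left, per unit of [gap], once the growth of the weight [root k] is paid for. In [K']
    the extra factor bounds [(k + 2) / (k + 1)] for [root k >= s0]. *)
Let kappa := gamma1 * c - s0^-1.
Let K' := K * (1 + (s0 ^+ 2)^-1).
Let E := ns_expect gamma rho p sigma x0.
Let q k := E k (odds (d / (gap * root k))).

Let root_gt0 k : 0 < root k. Proof. by rewrite sqrtr_gt0 ltr0n. Qed.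
Let root_sqr k : root k ^+ 2 = k.+1%:R. Proof. by rewrite sqr_sqrtr. Qed.
Let root_ge1 k : 1 <= root k.
Proof. by rewrite -[leLHS]sqrtr1 ler_psqrt ?nnegrE // ler1n. Qed.
Let root_le k l : (k <= l)%N -> root k <= root l.
Proof. by move=> kl; rewrite ler_psqrt ?nnegrE // ler_nat. Qed.

Let step_itv (a : R) k : 0 < a < 1 -> 0 <= a / root k <= 1.
Proof.
move=> /andP[a0 a1]; apply/andP; split; first by rewrite divr_ge0 // ltW.
by rewrite ler_pdivrMr // mul1r; exact: le_trans (ltW a1) (root_ge1 k).
Qed.

Let E_le n f g : (forall x, 0 <= x <= 1 -> f x <= g x) -> E n f <= E n g.
Proof.
apply: ns_expect_le => //.
- by move=> k; rewrite gammaE; exact: step_itv.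
- by move=> k; rewrite rhoE; exact: step_itv.
- by case/andP: sigma_itv => -> /ltW.
- by case/andP: x0_itv => /ltW -> /ltW.
Qed.

Let delta_gt0 k : 0 < d / (gap * root k).
Proof. by rewrite divr_gt0 // mulr_gt0. Qed.

Let K'_ge0 : 0 <= K'.
Proof.
case/andP: gamma1_itv => g0 _; case/andP: rho1_itv => r0 _.
apply: mulr_ge0; last by rewrite addr_ge0 // invr_ge0 sqr_ge0.
apply: le_trans K_ge; rewrite !mulr_ge0 ?addr_ge0 ?divr_ge0 ?mulr_ge0 //; exact: ltW.
Qed.

Let odds_ge0 k x : 0 <= x <= 1 -> 0 <= odds (d / (gap * root k)) x.
Proof.
by move=> /andP[x0' x1]; rewrite divr_ge0 ?subr_ge0 // addr_ge0 // ltW.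
Qed.

Let q_ge0 k : 0 <= q k.
Proof.
rewrite -[leLHS](ns_expect_cst gamma rho p sigma x0 k).
by apply: E_le => x; exact: odds_ge0.
Qed.

(** When numerator and denominator are multiplied by [gap * root l], the numerator becomes
    proportional to [root l] and the denominator [gap * root l * x + d] is nondecreasing in [l]. *)
Lemma odds_root_le k x : 0 <= x <= 1 ->
  odds (d / (gap * root k.+1)) x <=
  root k.+1 / root k * odds (d / (gap * root k)) x.
Proof.
move=> /andP[xge0 xle1].
have H (l : nat) : odds (d / (gap * root l)) x =
    gap * root l * (1 - x) / (gap * root l * x + d).
  have a0 : 0 < gap * root l * x + d.
    by rewrite ltr_wpDl // !mulr_ge0 // ltW.
  by rewrite /odds; field; rewrite !gt_eqF.
have -> : root k.+1 / root k * odds (d / (gap * root k)) x =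
    gap * root k.+1 * (1 - x) / (gap * root k * x + d).
  by rewrite H; field; rewrite !gt_eqF // ltr_wpDl // !mulr_ge0 // ltW.
rewrite H; apply: ler_wpM2l.
  by rewrite !mulr_ge0 ?subr_ge0 // ltW.
rewrite lef_pV2 ?posrE; [|by rewrite ltr_wpDl // !mulr_ge0 // ltW..].
by rewrite lerD2r; apply: ler_wpM2r => //; rewrite ler_pM2l // root_le.
Qed.

(* Comparing the odds at times [k] and [k.+1] costs a factor [root k.+1 / root k];
   together with the weight [root k] this gives [(k + 2) / (k + 1)], which the
   decay rate [gamma1 * c * gap / root k] beats since [gap * root k >= s0]. *)
Lemma potential_step k : s0 <= gap * root k ->
  root k.+1 * q k.+1 + kappa * gap * q k <= root k * q k + K' / root k.
Proof.
move=> s0r.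
have r0 := root_gt0 k; have r0' := root_gt0 k.+1.
have q0 := q_ge0 k.
have q1 : q k.+1 <= root k.+1 / root k *
    (q k * (1 - gamma1 * c * gap / root k) + K / root k ^+ 2).
  apply: (@le_trans _ _ (E k.+1 (fun x => root k.+1 / root k *
      odds (d / (gap * root k)) x))).
    by apply: E_le => x; exact: odds_root_le.
  rewrite /E ns_expectZ; apply: ler_wpM2l; first by rewrite divr_ge0 // ltW.
  rewrite /= gammaE rhoE.
  apply: (@le_trans _ _ (E k (fun x => (1 - gamma1 * c * gap / root k) *
      odds (d / (gap * root k)) x + K / root k ^+ 2))).
    apply: E_le => x x01; apply: le_trans (odds_drift_le s0r x01) _.
    by rewrite [leLHS]addrC [leRHS]addrC lerD2l mulrC.
  by rewrite /E ns_expect_lin ns_expect_cst [_ * ns_expect _ _ _ _ _ _ _]mulrC.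
have r2 : root k.+1 ^+ 2 = root k ^+ 2 + 1.
  by rewrite !root_sqr -[in LHS]natr1.
have rg : (root k)^-1 <= gap / s0.
  by rewrite ler_pdivlMr // -ler_pdivlMl ?invr_gt0 // invrK mulrC.
have rs : (root k ^+ 2)^-1 <= (s0 ^+ 2)^-1.
  rewrite lef_pV2 ?posrE ?exprn_gt0 // ler_sqr ?nnegrE ?(ltW r0) ?(ltW s0_gt0) //.
  by apply: le_trans s0r _; apply: ler_piMl => //; exact: ltW.
have := ler_wpM2l (ltW r0') q1.
have -> : root k.+1 * (root k.+1 / root k *
    (q k * (1 - gamma1 * c * gap / root k) + K / root k ^+ 2)) =
    root k * q k - gamma1 * c * gap * q k + (root k)^-1 * q k
    - gamma1 * c * gap / root k ^+ 2 * q k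
    + K * (1 + (root k ^+ 2)^-1) / root k.
  rewrite [LHS](_ : _ = root k.+1 ^+ 2 * (q k * (1 - gamma1 * c * gap / root k)
    + K / root k ^+ 2) / root k); last by ring.
  by rewrite r2; field; rewrite gt_eqF.
have K0 : 0 <= K.
  have := K'_ge0; rewrite /K' pmulr_lge0 //.
  by rewrite ltr_pwDl // invr_ge0 sqr_ge0.
have h1 : K * (1 + (root k ^+ 2)^-1) / root k <= K' / root k.
  by rewrite ler_pM2r ?invr_gt0 // ler_wpM2l // lerD2l.
have h2 : (root k)^-1 * q k <= gap / s0 * q k by exact: ler_wpM2r.
have h3 : 0 <= gamma1 * c * gap / root k ^+ 2 * q k.
  case/andP: gamma1_itv => g0 _.
  by rewrite !mulr_ge0 ?invr_ge0 ?sqr_ge0 // ltW.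
have -> : kappa * gap * q k = gamma1 * c * gap * q k - gap / s0 * q k.
  by rewrite /kappa; ring.
by lra.
Qed.

(** Each term is at most twice the increment of the square root; cleared of denominators, this is
    the nonnegativity of [(root n - t) ^+ 2]. *)
Let sum_inv_root n : \sum_(0 <= k < n) (root k)^-1 <= 2 * Num.sqrt n%:R.
Proof.
elim: n => [|n IH]; first by rewrite big_geq // sqrtr0 mulr0.
rewrite big_nat_recr //= -/(root n); apply: le_trans (lerD IH (lexx _)) _.
have r0 := root_gt0 n; set t : R := Num.sqrt n%:R.
have t2 : t ^+ 2 = root n ^+ 2 - 1.
  by rewrite sqr_sqrtr // root_sqr -natr1 addrK.
have t0 : 0 <= t by exact: sqrtr_ge0.
rewrite -(ler_pM2r r0) mulrDl mulVf ?gt_eqF //.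
have := sqr_ge0 (root n - t); nra.
Qed.

Lemma potential_telescope k0 m : s0 <= gap * root k0 ->
  root (k0 + m) * q (k0 + m) + kappa * gap * \sum_(k0 <= k < k0 + m) q k <=
  root k0 * q k0 + K' * \sum_(k0 <= k < k0 + m) (root k)^-1.
Proof.
move=> s0r; elim: m => [|m IH]; first by rewrite addn0 !big_geq // !mulr0 !addr0.
rewrite addnS !big_nat_recr ?leq_addr //= !mulrDr.
have s0r' : s0 <= gap * root (k0 + m).
  by apply: le_trans s0r _; rewrite ler_pM2l // root_le // leq_addr.
have := potential_step s0r'; move: IH.
set A := \sum_(_ <= _ < _) _; set B := \sum_(_ <= _ < _) _; lra.
Qed.

Definition cumulated_regret n : R :=
  gap * \sum_(0 <= k < n) E k (fun x => 1 - x).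

Lemma cumulated_regret_le_gap n : cumulated_regret n <= gap * n%:R.
Proof.
rewrite /cumulated_regret ler_pM2l //.
apply: (@le_trans _ _ (\sum_(0 <= k < n) 1)).
  apply: ler_sum => k _; rewrite -[leRHS](ns_expect_cst gamma rho p sigma x0 k).
  by apply: E_le => x /andP[? _]; lra.
by rewrite sumr_const_nat subn0.
Qed.

Lemma cumulated_regret_le n :
  cumulated_regret n <=
    (s0 ^+ 2 + (1 + d / s0) / kappa * ((s0 ^+ 2 + 1) / d)) / gap
    + (1 + d / s0) / kappa * (2 * K') * Num.sqrt n%:R.
Proof.
have kap : 0 < kappa by [].
pose L := (1 + d / s0) / kappa.
have L0 : 0 < L by rewrite divr_gt0 // addr_gt0 // divr_gt0.
(* [k0] is large enough for [gap * root k0] to exceed [s0], and small enough for the trivial bound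
   up to [k0] to cost at most [s0 ^+ 2 / gap]. *)
rewrite -/L; pose k0 := Num.truncn (s0 ^+ 2 / gap ^+ 2).
have /andP[k0le ltk0] : k0%:R <= s0 ^+ 2 / gap ^+ 2 < k0.+1%:R.
  by apply: truncn_itv; rewrite divr_ge0 ?sqr_ge0.
have head : gap * k0%:R <= s0 ^+ 2 / gap.
  rewrite [leRHS](_ : _ = gap * (s0 ^+ 2 / gap ^+ 2)).
    by rewrite ler_pM2l.
  by field; rewrite gt_eqF.
have [nk0|k0n] := leqP n k0.
  apply: le_trans (cumulated_regret_le_gap n) _.
  apply: (@le_trans _ _ (s0 ^+ 2 / gap)).
    by apply: le_trans head; rewrite ler_pM2l // ler_nat.
  rewrite mulrDl -addrA lerDl addr_ge0 //.
    apply: divr_ge0 (ltW gap_gt0); apply: mulr_ge0 (ltW L0) _.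
    by rewrite divr_ge0 ?addr_ge0 ?sqr_ge0 // ltW.
  by apply: mulr_ge0 (sqrtr_ge0 _); apply: mulr_ge0 (ltW L0) _; rewrite mulr_ge0.
have s0r : s0 <= gap * root k0.
  rewrite -ler_sqr ?nnegrE ?(ltW s0_gt0) ?mulr_ge0 ?(ltW gap_gt0) ?(ltW (root_gt0 _)) //.
  rewrite exprMn root_sqr mulrC -ler_pdivrMr ?exprn_gt0 //; exact: ltW.
have [m ->] : exists m, n = (k0 + m)%N.
  by exists (n - k0)%N; rewrite (subnKC (ltnW k0n)).
rewrite /cumulated_regret (big_cat_nat _ (n := k0)) ?leq_addr //= mulrDr.
have h1 : gap * \sum_(0 <= k < k0) E k (fun x => 1 - x) <= s0 ^+ 2 / gap.
  exact: le_trans (cumulated_regret_le_gap k0) head.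
(* The regret term is the odds times [x + delta], a factor at most [1 + d / s0] from time [k0]
   on. *)
have h2 : \sum_(k0 <= k < k0 + m) E k (fun x => 1 - x) <=
    (1 + d / s0) * \sum_(k0 <= k < k0 + m) q k.
  rewrite mulr_sumr big_nat [leRHS]big_nat; apply: ler_sum => k /andP[k0k _].
  rewrite -ns_expectZ; apply: E_le => x x01.
  have a0 : 0 < x + d / (gap * root k) by rewrite ltr_wpDl //; case/andP: x01.
  rewrite /odds mulrA ler_pdivlMr // mulrC; case/andP: x01 => xge0 xle1.
  apply: ler_wpM2r; first by rewrite subr_ge0.
  apply: lerD => //; rewrite ler_pM2l // lef_pV2 ?posrE ?mulr_gt0 //.
  by apply: le_trans s0r _; rewrite ler_pM2l // root_le.
(* The odds never exceed the inverse of the regularization, and [gap ^+ 2 * (k0 + 1) <= s0 ^+ 2 + 1]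
   by the choice of [k0]. *)
have q0 : root k0 * q k0 <= (s0 ^+ 2 + 1) / d / gap.
  apply: (@le_trans _ _ (root k0 * (gap * root k0 / d))).
    rewrite ler_pM2l // -[leRHS](ns_expect_cst gamma rho p sigma x0 k0).
    apply: E_le => x /andP[xge0 xle1]; rewrite -[leRHS]invf_div /odds.
    rewrite ler_pdivrMr ?ltr_wpDl //; apply: (@le_trans _ _ 1); first by lra.
    by rewrite mulrDr mulVf ?gt_eqF // lerDr mulr_ge0 ?invr_ge0 // ltW.
  have -> : root k0 * (gap * root k0 / d) = gap ^+ 2 * root k0 ^+ 2 / d / gap.
    by field; rewrite !gt_eqF.
  rewrite ler_pM2r ?invr_gt0 // ler_pM2r ?invr_gt0 // root_sqr -natr1 mulrDr.
  rewrite mulr1 lerD //; last by rewrite expr_le1 // ltW.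
  by rewrite mulrC -ler_pdivlMr ?exprn_gt0.
have := potential_telescope m s0r.
have hs : \sum_(k0 <= k < k0 + m) (root k)^-1 <= 2 * Num.sqrt (k0 + m)%:R.
  apply: le_trans (sum_inv_root _); rewrite [leRHS](big_cat_nat _ (n := k0)) ?leq_addr //=.
  by rewrite lerDr sumr_ge0 // => k _; rewrite invr_ge0 ltW.
have hq : 0 <= root (k0 + m) * q (k0 + m) by rewrite mulr_ge0 // ltW.
have := ler_wpM2l K'_ge0 hs.
have := ler_wpM2l (ltW gap_gt0) h2.
move: h1 q0 hq; set A := \sum_(k0 <= k < _) q k; set B := \sum_(k0 <= k < _) _^-1.
set Z := gap * \sum_(0 <= _ < _) _; set Y := gap * \sum_(_ <= _ < _) _.
set X := root k0 * q k0; set W := root _ * _; set N := Num.sqrt _.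
move=> h1 q0 hq h3 h4 h5.
have h6 : kappa * gap * A <= (s0 ^+ 2 + 1) / d / gap + 2 * K' * N by lra.
have h7 : gap * ((1 + d / s0) * A) = L * (kappa * gap * A).
  by rewrite /L; field; rewrite !gt_eqF.
rewrite h7 in h3; rewrite [leRHS](_ : _ =
  s0 ^+ 2 / gap + L * ((s0 ^+ 2 + 1) / d / gap + 2 * K' * N)); last by ring.
exact: lerD h1 (le_trans h3 (ler_wpM2l (ltW L0) h6)).
Qed.

(* If [gap * sqrt n <= T] the trivial bound [gap * n] is enough; otherwise
   [1 / gap] is at most [sqrt n / T]. *)
Lemma cumulated_regret_le_sqrt T B n : 0 < T <= B ->
  (s0 ^+ 2 + (1 + d / s0) / kappa * ((s0 ^+ 2 + 1) / d)) / T
    + (1 + d / s0) / kappa * (2 * K') <= B ->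
  cumulated_regret n <= B * Num.sqrt n%:R.
Proof.
move=> /andP[T0 TB] MB; have t0 : 0 <= Num.sqrt n%:R :> R by exact: sqrtr_ge0.
have L0 : 0 < (1 + d / s0) / kappa by rewrite divr_gt0 // addr_gt0 // divr_gt0.
have [small|large] := leP (gap * Num.sqrt n%:R) T.
  apply: le_trans (cumulated_regret_le_gap n) _.
  rewrite -[n%:R in leLHS]sqr_sqrtr // expr2 mulrA; apply: ler_wpM2r => //.
  exact: le_trans small TB.
apply: le_trans (cumulated_regret_le n) _.
apply: le_trans (ler_wpM2r t0 MB); rewrite [leRHS]mulrDl lerD2r -[leRHS]mulrA.
apply: ler_wpM2l.
  rewrite addr_ge0 ?sqr_ge0 // mulr_ge0 ?(ltW L0) // divr_ge0 ?(ltW d_gt0) //.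
  by rewrite addr_ge0 ?sqr_ge0.
by rewrite -[leLHS]mul1r ler_pdivrMr // -mulrA ler_pdivlMl // mulr1 mulrC ltW.
Qed.

End cumulated.
End lyapunov.

(** * Law of the bandit process *)

Section finite_range.
Context d (T : measurableType d) (R : realType) (P : probability T R).
Variables (K : eqType) (Z : T -> K) (s : seq K) (h : K -> R).
Hypotheses (s_uniq : uniq s) (Zs : forall w, Z w \in s)
  (mZ : forall k, measurable (Z @^-1` [set k])).

(** A variable with finitely many values is a finite combination of indicators, which turns
    integrals over the process into finite sums. *)
Let finite_rangeE : (fun w => (h (Z w))%:E) =
  (fun w => \sum_(k <- s) (h k)%:E * (\1_(Z @^-1` [set k]) w)%:E)%E.
Proof.
apply/funext => w; rewrite (bigD1_seq (Z w)) //= big1 ?adde0.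
  by rewrite indicE mem_set // mule1.
by move=> k kZ; rewrite indicE memNset ?mule0 //= => e; rewrite e eqxx in kZ.
Qed.

Lemma integrable_finite_range : P.-integrable setT (fun w => (h (Z w))%:E).
Proof.
rewrite finite_rangeE; apply: integrable_sum => // k _.
by apply: integrableZl => //; exact: integrable_indic.
Qed.

Lemma integral_finite_range : (\int[P]_w (h (Z w))%:E =
  (\sum_(k <- s) h k * fine (P (Z @^-1` [set k])))%:E)%E.
Proof.
rewrite finite_rangeE integral_sum // => [|k]; last first.
  by apply: integrableZl => //; exact: integrable_indic.
rewrite -sumEFin; apply: eq_bigr => k _.
rewrite integralZl //; last exact: integrable_indic.
by rewrite integral_indic // setIT EFinM fineK // fin_num_measure.
Qed.

End finite_range.

(** * Transfer from the chain to the realized process *)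

Section realization.
Context d (T : measurableType d) (R : realType) (P : probability T R).
Variables (sigma : R) (gamma rho : R^nat) (x0 : R) (p : bool -> R)
  (A : bool -> nat -> {RV P >-> bool}) (B I : nat -> {RV P >-> bool}).
Hypotheses (bandit : over_penalized_bandit sigma gamma rho x0 p A B I)
  (p01 : forall i, 0 <= p i <= 1) (sigma01 : 0 <= sigma <= 1).

Let X := ns_prob gamma rho x0 A B I.
Let mean := outcome_mean p sigma.
Let E := ns_expect gamma rho p sigma x0.

Lemma measurable_obtained_reward n :
  measurable_fun setT (obtained_reward A I n : T -> bool).
Proof.
rewrite [X in measurable_fun _ X](_ : _ =
  fun w => if I n w then A true n w else A false n w).
  by apply: measurable_fun_ifT; exact: measurable_funP.
by apply/funext => w; rewrite /obtained_reward; case: (I n w).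
Qed.

Lemma history_measurable n H : history A B I n H -> measurable H.
Proof.
apply: smallest_sub; first exact: sigma_algebra_measurable.
move=> _ [k _ [D mD <-]]; suff : measurable_fun setT (observation A B I k) by exact.
apply: measurable_fun_pair; last exact: measurable_funP.
apply: measurable_fun_pair; first exact: measurable_funP.
exact: measurable_obtained_reward.
Qed.

Lemma state_history n v : history A B I n (X n @^-1` [set v]).
Proof. by have [+ _] := arm1_cond_prob bandit n; apply. Qed.

Let measurable_state n v : measurable (X n @^-1` [set v]).
Proof. exact: history_measurable (state_history v). Qed.

(** The event that the state is [v] lies in the history, and on it the conditional probability of
    arm [i] is the constant [bern v i]. *)
Lemma arm_prob n v i : (P (X n @^-1` [set v] `&` I n.+1 @^-1` [set i]) =
  (bern v i)%:E * P (X n @^-1` [set v]))%E.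
Proof.
rewrite -integral_cst //; case: i.
- have [_ ->] := arm1_cond_prob bandit n; last exact: state_history.
  by apply: eq_integral => w; rewrite inE /= => <-.
- have [_ ->] := arm2_cond_prob bandit n; last exact: state_history.
  by apply: eq_integral => w; rewrite inE /= => <-.
Qed.

Lemma bernoulli_prob1 (q : R) b : 0 <= q <= 1 ->
  bernoulli_prob q [set b] = (bern q b)%:E.
Proof.
move=> q01; rewrite bernoulli_probE // !diracE.
have e c : (c \in [set b]) = (c == b) by apply/idP/eqP; rewrite inE.
by rewrite !e; case: b {e} => /=; rewrite mule1 mule0 ?adde0 ?add0e.
Qed.

Lemma noise_prob n i a b : (P (A i n.+1 @^-1` [set a] `&` B n.+1 @^-1` [set b]) =
  (bern (p i) a * bern sigma b)%:E)%E.
Proof.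
have := noise_independent bandit (s := [:: inl (i, n); inr n])
  (D := fun k => if k is inl _ then [set a] else [set b]) isT.
move=> /(_ _)/wrap[]; first by case.
rewrite bigcap_seq !big_cons !big_nil /= setIT mule1 => ->.
rewrite EFinM; congr (_ * _)%E.
- by rewrite -bernoulli_prob1 // -(reward_law bandit _ n).
- by rewrite -bernoulli_prob1 // -(penalty_law bandit n).
Qed.

Definition state_outcome n w : R * (bool * bool * bool) :=
  (X n w, observation A B I n.+1 w).

(** Once the arm is fixed, the obtained reward is that arm's own reward; the event is then a
    fresh-noise event [D] intersected with one of the history and choice, and [noise_fresh] factors
    the probability. *)
Lemma state_outcome_prob n v z : P (state_outcome n @^-1` [set (v, z)]) =
  (outcome_prob p sigma v z * fine (P (X n @^-1` [set v])))%:E.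
Proof.
case: z => [[i a] b].
pose D : set (bool * bool * bool) :=
  [set t | (if i then t.1.1 else t.1.2) = a /\ t.2 = b].
have -> : state_outcome n @^-1` [set (v, (i, a, b))] =
    fresh_noise A B n.+1 @^-1` D `&`
    (X n @^-1` [set v] `&` I n.+1 @^-1` [set i]).
  apply/seteqP; split => w /=; rewrite /state_outcome /observation /obtained_reward /D /=.
    by case=> -> <- <- <-; split => //; case: (I n.+1 w).
  by case=> -[<- <-] [-> ->]; case: i {D}.
rewrite (noise_fresh bandit (n := n)); last 2 first.
- exists D; last by rewrite setTI.
  rewrite (_ : D = (if i then [set a] `*` setT else setT `*` [set a]) `*` [set b]).
    by apply: measurableX => //; case: i {D}; apply: measurableX.
  by apply/seteqP; split => -[[t1 t2] t3] /=; rewrite /D; case: i {D} => /=; tauto.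
- have hX : history_and_choice A B I n (X n @^-1` [set v]).
    by apply: sub_sigma_algebra2 (state_history v); exact: subsetUl.
  have hI : history_and_choice A B I n (I n.+1 @^-1` [set i]).
    by apply: sub_sigma_algebra; right; exists [set i] => //; rewrite setTI.
  exact: (@measurableI _ (g_sigma_algebraType _) _ _ hX hI).
have -> : fresh_noise A B n.+1 @^-1` D =
    A i n.+1 @^-1` [set a] `&` B n.+1 @^-1` [set b].
  by rewrite /D; case: i {D}.
rewrite noise_prob arm_prob -[P (X n @^-1` _)]fineK ?fin_num_measure //.
by rewrite -!EFinM; congr (_%:E); rewrite /outcome_prob /=; ring.
Qed.

(** The initial state is deterministic and each transition has eight outcomes. *)
Lemma state_finite_range n : exists2 s : seq R, uniq s & forall w, X n w \in s.
Proof.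
elim: n => [|n [s _ Xs]]; first by exists [:: x0] => // w; rewrite inE.
exists (undup [seq ns_step (gamma n.+1) (rho n.+1) v z | v <- s,
  z <- index_enum (bool * bool * bool)%type]) => [|w]; first exact: undup_uniq.
rewrite mem_undup; apply/allpairsP; exists (state_outcome n w).
by split; [exact: Xs | exact: mem_index_enum |].
Qed.

Let measurable_state_outcome n k : measurable (state_outcome n @^-1` [set k]).
Proof.
case: k => v z; have -> : state_outcome n @^-1` [set (v, z)] =
    X n @^-1` [set v] `&` observation A B I n.+1 @^-1` [set z].
  by apply/seteqP; split => w /=; [case=> <- <-|case=> <- <-].
apply: measurableI => //; apply: (@history_measurable n.+1).
apply: sub_sigma_algebra; exists n.+1 => //=; exists [set z]; last by rewrite setTI.
case: z => [[i a] b]; rewrite (_ : [set _] = [set i] `*` [set a] `*` [set b]).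
  by apply: measurableX => //; exact: measurableX.
by apply/seteqP; split => -[[t1 t2] t3] /=; [case=> -> -> ->|case=> -[-> ->] ->].
Qed.

(** Since [h] sees the whole outcome and not only the next state, the same identity serves for the
    transition of the chain and for the reward obtained. *)
Lemma one_step_expectation n (h : R * (bool * bool * bool) -> R) :
  P.-integrable setT (fun w => (h (state_outcome n w))%:E) /\
  (\int[P]_w (h (state_outcome n w))%:E =
   \int[P]_w (mean (X n w) (fun z => h (X n w, z)))%:E)%E.
Proof.
have [s us Xs] := state_finite_range n.
pose t := [seq (v, z) | v <- s, z <- index_enum (bool * bool * bool)%type].
have ut : uniq t.
  by apply: allpairs_uniq => //; [exact: index_enum_uniq | move=> [? ?] [? ?]].
have Zt w : state_outcome n w \in t.
  apply/allpairsP; exists (state_outcome n w).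
  by split; [exact: Xs | exact: mem_index_enum |].
have mZ := @measurable_state_outcome n.
split; first exact: (integrable_finite_range P h ut Zt mZ).
rewrite (integral_finite_range P h ut Zt mZ).
rewrite (integral_finite_range P (fun v => mean v (fun z => h (v, z))) us Xs) //.
congr (_%:E); rewrite big_allpairs; apply: eq_bigr => v _.
rewrite /mean /outcome_mean mulr_suml; apply: eq_bigr => z _.
by rewrite state_outcome_prob /=; ring.
Qed.

Lemma state_expectation n f : (\int[P]_w (f (X n w))%:E = (E n f)%:E)%E.
Proof.
elim: n f => [|n IH] f /=; first by rewrite integral_cst //= probability_setT mule1.
rewrite -IH; have [_] := one_step_expectation n
  (fun u => f (ns_step (gamma n.+1) (rho n.+1) u.1 u.2)).
exact.
Qed.

Let mA i k b : measurable (A i k @^-1` [set b]).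
Proof. exact: measurable_funPTI. Qed.

(** The arm at time [k + 1] is drawn from [X k], so its mean reward is [p arm1] minus the gap times
    the mean of [1 - X k]. Comparison with arm 2 only adds the nonpositive [p arm2 - p arm1] to each
    term. *)
Lemma pseudo_regret_le n : p arm2 <= p arm1 ->
  (pseudo_regret A I n <=
   ((p arm1 - p arm2) * \sum_(0 <= k < n) E k (fun x => 1 - x))%:E)%E.
Proof.
move=> p21.
have iA j k : P.-integrable setT (fun w => (A j k.+1 w)%:R%:E : \bar R).
  apply: (@integrable_finite_range _ _ _ P _ _ [:: true; false] (fun b : bool => b%:R)) => // w.
  by case: (A _ _ _).
have EA j k : (\int[P]_w (A j k.+1 w)%:R%:E = (p j)%:E)%E.
  rewrite (@integral_finite_range _ _ _ P _ _ [:: true; false] (fun b : bool => b%:R)) //; last first.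
    by move=> w; case: (A _ _ _).
  rewrite !big_cons big_nil mul0r mul1r !addr0.
  have -> : P (A j k.+1 @^-1` [set true]) = (p j)%:E.
    by rewrite -[RHS]/((bern (p j) true)%:E) -bernoulli_prob1 // -(reward_law bandit j k).
  by [].
have [iO EO] : (forall k, P.-integrable setT
      (fun w => (obtained_reward A I k.+1 w)%:R%:E : \bar R))
  /\ forall k, (\int[P]_w (obtained_reward A I k.+1 w)%:R%:E =
      (p arm1 - (p arm1 - p arm2) * E k (fun x => 1 - x))%:E)%E.
  split=> k; have [i e] := one_step_expectation k (fun u => u.2.1.2%:R); first exact: i.
  rewrite e [RHS](_ : _ = (E k (fun x => - (p arm1 - p arm2) * (1 - x) + p arm1))%:E).
    rewrite -state_expectation; apply: eq_integral => w _; congr (_%:E).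
    by rewrite /mean outcome_meanE /=; ring.
  by rewrite /E ns_expect_lin ns_expect_cst; congr (_%:E); ring.
have Eg j : ('E_P[(fun w => \sum_(1 <= k < n.+1)
     ((A j k w)%:R - (obtained_reward A I k w)%:R))%R] =
   (\sum_(0 <= k < n) (p j - p arm1 + (p arm1 - p arm2) * E k (fun x => 1 - x)))%R%:E)%E.
  rewrite unlock; under eq_integral do rewrite big_add1 -sumEFin /=.
  rewrite integral_sum // => [|k]; last first.
    by under eq_fun do rewrite EFinB; exact: integrableB.
  rewrite -sumEFin; apply: eq_bigr => k _.
  under eq_integral do rewrite EFinB.
  by rewrite (integralB_EFin _ (iA j k) (iO k)) // EA EO -EFinB; congr (_%:E); ring.
rewrite /pseudo_regret /= ge_max !Eg !lee_fin mulr_sumr.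
by apply/andP; split; apply: ler_sum => k _; lra.
Qed.

End realization.

(** * Bounds uniform in the success probabilities, and choice of the constants *)

Lemma worst_pseudo_regret_le (R : realType)
  (gamma1 rho1 sigma s0 d c G K T B : R) (gamma rho : R^nat) (x0 : R) (n : nat) :
  0 < gamma1 < 1 -> 0 < rho1 < 1 -> 0 <= sigma < 1 -> 1 < s0 -> 0 < d -> 0 < c ->
  gamma1 <= G * (1 - gamma1 / s0) ->
  gamma1 * rho1 * (1 + d / s0) * (1 + G * rho1 / s0 ^+ 2) <= K ->
  (forall u : R, 0 <= u ->
     c * (u + d) <= u * (1 - rho1 / s0) + rho1 * (1 - sigma)
                    - G * (u / (u + d)) - G * rho1 ^+ 2 / (s0 * d)) ->
  (forall k, gamma k.+1 = gamma1 / Num.sqrt k.+1%:R) ->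
  (forall k, rho k.+1 = rho1 / Num.sqrt k.+1%:R) ->
  0 < x0 < 1 ->
  0 < gamma1 * c - s0^-1 -> 0 < T <= B ->
  (s0 ^+ 2 + (1 + d / s0) / (gamma1 * c - s0^-1) * ((s0 ^+ 2 + 1) / d)) / T
    + (1 + d / s0) / (gamma1 * c - s0^-1) * (2 * (K * (1 + (s0 ^+ 2)^-1))) <= B ->
  (worst_pseudo_regret sigma gamma rho x0 n <= (B * Num.sqrt n%:R)%R%:E)%E.
Proof.
move=> gamma1_itv rho1_itv sigma_itv s0_gt1 d_gt0 c_gt0 G_ge K_ge drift_ge.
move=> gammaE rhoE x0_itv kappa_gt0 TB MB.
apply: ge_ereal_sup => _ [p [d' [S [P [A [Bv [I [p2_ge0 p21 p1_le1 bandit ->]]]]]]]].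
have p01 i : 0 <= p i <= 1 by case: i; apply/andP; split; lra.
have sigma01 : 0 <= sigma <= 1 by case/andP: sigma_itv => -> /ltW.
apply: le_trans (pseudo_regret_le bandit p01 sigma01 n (ltW p21)) _.
rewrite lee_fin.
exact: (cumulated_regret_le_sqrt gamma1_itv rho1_itv sigma_itv s0_gt1 d_gt0 c_gt0
  G_ge K_ge drift_ge p2_ge0 p21 p1_le1 erefl gammaE rhoE x0_itv kappa_gt0 n TB MB).
Qed.

Lemma worst_pseudo_regret_sqrt (R : realType) (sigma gamma1 rho1 : R) :
  0 <= sigma < 1 -> 0 < gamma1 < 1 -> 0 < rho1 < 1 ->
  exists C : R, forall x0 : R, 0 < x0 < 1 -> forall n : nat,
    (worst_pseudo_regret sigma
       (fun k => gamma1 / Num.sqrt k%:R)%R (fun k => rho1 / Num.sqrt k%:R)%R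
       x0 n
     <= (C * Num.sqrt n%:R)%R%:E)%E.
Proof.
(* With [e = rho1 (1 - sigma)], the choice [d = 4], [c = e / 8],
   [s0 = 16 / (gamma1 e)] works; [v] is [s0^-1]. *)
move=> sigma_itv gamma1_itv rho1_itv.
have /andP[sg0 sg1] := sigma_itv; have /andP[g0 g1] := gamma1_itv.
have /andP[r0 r1] := rho1_itv.
pose e := rho1 * (1 - sigma); pose v := gamma1 * e / 16.
have e0 : 0 < e by rewrite mulr_gt0 // subr_gt0.
have er : e <= rho1 by apply: ler_piMr; [exact: ltW | lra].
have v0 : 0 < v by rewrite divr_gt0 // mulr_gt0.
have ge1 : gamma1 * e <= e by apply: ler_piMl; exact: ltW.
have v16 : v <= e / 16 by rewrite ler_pM2r.
pose K := gamma1 * rho1 * (1 + 4 / v^-1) * (1 + 2 * gamma1 * rho1 / v^-1 ^+ 2).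
pose kap := gamma1 * (e / 8) - v^-1^-1.
pose M := (v^-1 ^+ 2 + (1 + 4 / v^-1) / kap * ((v^-1 ^+ 2 + 1) / 4)) / 1
    + (1 + 4 / v^-1) / kap * (2 * (K * (1 + (v^-1 ^+ 2)^-1))).
(* [K] and [M] are the smallest values allowed with [G = 2 * gamma1] and [T = 1]; the maximum with 1
   ensures that [T] is at most the final constant. *)
exists (Num.max 1 M) => x0 x0_itv n.
apply: (@worst_pseudo_regret_le _ gamma1 rho1 sigma v^-1 4 (e / 8) (2 * gamma1) K 1) => //.
- by rewrite invf_gt1 //; lra.
- by rewrite divr_gt0.
- rewrite invrK; nra.
(* The losses [u / 2] from [G], [u / 16] from the penalty and [e * u / 8] from the decay fit into
   [u]; among the constants, [e / 2] and [v / 2] fit into [e]. *)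
- move=> u u0; rewrite !invrK [_ / (v^-1 * 4)](_ : _ = 2 * gamma1 * rho1 ^+ 2 * v / 4).
    have uu : u / (u + 4) <= u / 4.
      apply: ler_wpM2l => //; rewrite lef_pV2 ?posrE //; lra.
    have h1 : 2 * gamma1 * (u / (u + 4)) <= u / 2.
      apply: (@le_trans _ _ (2 * (u / 4))); last by lra.
      by apply: ler_pM => //; [lra | rewrite divr_ge0 // addr_ge0 | lra].
    have h2 : gamma1 * rho1 ^+ 2 * v <= v.
      apply: ler_piMl; first exact: ltW.
      by rewrite mulr_ile1 ?exprn_ile1 ?sqr_ge0 // ltW.
    have h3 : u * (rho1 * v) <= u * (1 / 16) by apply: ler_wpM2l => //; nra.
    have h4 : e * u <= u by apply: ler_piMl => //; lra.
    have h5 : rho1 * (1 - sigma) = e by [].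
    by rewrite h5; move: (2 * gamma1 * (u / (u + 4))) h1 => Z h1; lra.
  by field; rewrite gt_eqF.
(* The rate [gamma1 * c - s0^-1] equals [v] here. *)
- by rewrite invrK /v; nra.
- by rewrite ltr01 le_max lexx.
- by rewrite -/kap -/M le_max lexx orbT.
Qed.

Lemma worst_pseudo_regret_explicit (R : realType) (gamma rho : R^nat) :
  (forall k, (0 < k)%N -> gamma k = 263%:R / 100%:R * rho k) ->
  (forall k, (0 < k)%N -> gamma k = (89%:R / 100%:R) / Num.sqrt k%:R) ->
  forall x0 : R, 0 < x0 < 1 -> forall n : nat,
    (worst_pseudo_regret 0 gamma rho x0 n
     <= (311%:R / 10%:R * Num.sqrt (2 * n)%:R)%R%:E)%E.
Proof.
move=> gammarho gammaE x0 x0_itv n.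
have rhoE k : rho k.+1 = (89 / 263) / Num.sqrt k.+1%:R.
  by have := gammarho k.+1 isT; rewrite gammaE // => e; lra.
(* This rational bound is enough, as 43 is less than [311 / 10 * (7 / 5)]. *)
have sqrt2 : (7 / 5 : R) <= Num.sqrt 2.
  rewrite -[leLHS]ger0_norm; last lra.
  by rewrite -sqrtr_sqr ler_psqrt ?nnegrE; lra.
apply: (@le_trans _ _ (43 * Num.sqrt n%:R)%R%:E).
  (* Here [T = 43] stays below [311 / 10 * sqrt 2], and [1581 / 10000] below is
     [gamma1 * c - s0^-1]. *)
  apply: (@worst_pseudo_regret_le _ (89 / 100) (89 / 263) 0 10 1 (29 / 100) (978 / 1000)
    (1 / 3) 43) => //; try lra.
  (* Multiplied by [u + 1], the condition says that a quadratic in [u] is nonnegative; its minimum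
     is near 0.195, whence the square given to [nra]. *)
  - move=> u u0; have u1 : 0 < u + 1 by lra.
    have uw : u / (u + 1) * (u + 1) = u by rewrite divfK // gt_eqF.
    rewrite -(ler_pM2r u1) [leRHS]mulrBl [X in X - _]mulrBl -(mulrA (978 / 1000)) uw.
    by have := sqr_ge0 (u - 195 / 1000); nra.
  - by move=> k; rewrite gammaE.
  - have -> : 89 / 100 * (29 / 100) - 10^-1 = 1581 / 10000 :> R by lra.
    by rewrite invf_div; lra.
rewrite lee_fin natrM sqrtrM // mulrA; apply: ler_wpM2r; first exact: sqrtr_ge0.
by lra.
Qed.

Theorem theorem3p2 (R : realType) :
  (forall sigma gamma1 rho1 : R,
     0 <= sigma < 1 -> 0 < gamma1 < 1 -> 0 < rho1 < 1 ->
     exists C : R, forall x0 : R, 0 < x0 < 1 -> forall n : nat,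
       (worst_pseudo_regret sigma
          (fun k => gamma1 / Num.sqrt k%:R)%R (fun k => rho1 / Num.sqrt k%:R)%R
          x0 n
        <= (C * Num.sqrt n%:R)%R%:E)%E)
  /\
  (forall gamma rho : R^nat,
     (forall k, (0 < k)%N -> gamma k = 263%:R / 100%:R * rho k) ->
     (forall k, (0 < k)%N -> gamma k = (89%:R / 100%:R) / Num.sqrt k%:R) ->
     forall x0 : R, 0 < x0 < 1 -> forall n : nat,
       (worst_pseudo_regret 0 gamma rho x0 n
        <= (311%:R / 10%:R * Num.sqrt (2 * n)%:R)%R%:E)%E).
Proof.
split; first exact: worst_pseudo_regret_sqrt.
exact: worst_pseudo_regret_explicit.
Qed.
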